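(* Let $n, t$ be positive integers with $t \le n$ and let $\mathcal{A}, \mathcal{B} \subseteq \mathcal{P}([n])$ be such that the pair $(\mathcal{A}, \mathcal{B})$ is $t$-cross-avoiding, i.e. $|A \cap B| \ne t$ for all $A \in \mathcal{A}$, $B \in \mathcal{B}$. (It is a fact that then $d(\mathcal{A}, \mathcal{B}) \le \sum_{k=0}^{t-1} \binom{n}{k} 2^{n-k}$.) (1) If $t = 1$, then $d(\mathcal{A}, \mathcal{B}) = \sum_{k=0}^{t-1} \binom{n}{k} 2^{n-k} = 2^n$ if and only if there is a subset $S \subseteq [n]$ such that $\mathcal{A} = \mathcal{P}(S)$ and $\mathcal{B} = \mathcal{P}([n] \setminus S)$ (or vice versa). (2) If $t \ge 2$, then $d(\mathcal{A}, \mathcal{B}) = \sum_{k=0}^{t-1} \binom{n}{k} 2^{n-k}$ if and only if either $\mathcal{A} = [n]^{(\le t-1)}$ and $\mathcal{B} = \mathcal{P}([n])$, or $\mathcal{A} = \mathcal{P}([n])$ and $\mathcal{B} = [n]^{(\le t-1)}$.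
   Context: $[n] = \{1, \ldots, n\}$; $\mathcal{P}(X)$ is the power set of $X$; $[n]^{(\le t-1)}$ is the collection of all subsets of $[n]$ of size at most $t-1$. For $\mathcal{A}, \mathcal{B} \subseteq \mathcal{P}([n])$, $d(\mathcal{A}, \mathcal{B})$ is the number of pairs $(A,B) \in \mathcal{A} \times \mathcal{B}$ with $A \cap B = \varnothing$. *)

(* Defs.v *)
From mathcomp Require Import all_boot.

Set Implicit Arguments.
Unset Strict Implicit.
Unset Printing Implicit Defensive.

(* The ground set [n] = {1, ..., n} is represented by 'I_n = {0, ..., n-1};
   a family of subsets of [n] is an element of {set {set 'I_n}}. *)

Definition cross_avoiding (n t : nat) (A B : {set {set 'I_n}}) : Prop :=
  forall X Y : {set 'I_n}, X \in A -> Y \in B -> #|X :&: Y| <> t.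

Definition disj_pairs (n : nat) (A B : {set {set 'I_n}}) : nat :=
  #|[set p in setX A B | p.1 :&: p.2 == set0]|.

Definition subsets_le (n k : nat) : {set {set 'I_n}} :=
  [set X : {set 'I_n} | #|X| <= k].

Definition disj_bound (n t : nat) : nat :=
  \sum_(0 <= k < t) 'C(n, k) * 2 ^ (n - k).

(* Main.v *)
Require Import Defs.
From mathcomp Require Import all_boot.
From mathcomp Require Import zify.

(** The proof is an induction on the ground set G, splitting each family by an
    element x of G: let A0 be the members of A that avoid x, and A1 the members
    that contain x, with x removed; likewise B0 and B1. A disjoint pair never
    has x on both sides, so with d for the number of disjoint pairs,
    d(A, B) = d(A0, B0) + d(A0, B1) + d(A1, B0). Checking for each pair (X, Y)
    which of the four families contain X and Y turns this into

      d(A, B) + d(A0 \ A1, B0 \ B1)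
        = d(A0, B0 u B1) + d(A0 u A1, B0) + d(A0 n A1, B0 n B1).

    On G \ x the first two pairs on the right are t-avoiding, because adding x
    to one side only leaves the intersection unchanged; the third is
    (t-1)-avoiding, because X + x in A and Y + x in B meet in one more element
    than X and Y. The bound f(n, t) satisfies f(n, t) = 2 f(n-1, t) + f(n-1, t-1),
    so the inequality follows by induction ([dpairs_bound]).

    In case of equality all three pairs on the right are extremal and
    d(A0 \ A1, B0 \ B1) = 0 ([extremal_sections]). These four facts determine
    the families. For t = 1 the zero term forces the empty set into A1 or B1;
    since A and B are 1-avoiding, the other of A1, B1 is then empty
    ([extremal1]). For t >= 2 the pair (A0 n A1, B0 n B1) consists of the family
    of sets of size less than t-1 and of the full power set, in some order. If
    B0 n B1 is the full power set then so are B0 and B1, and the other two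
    extremal pairs leave one choice for A0 and for A0 u A1
    ([small_full_link]). When t = 2 the third pair is only known to be
    (P(S), P(G \ x \ S)); a proper nonempty S would make a pair of singletons
    contribute to the zero term ([extremal_ge2]). *)

Set Implicit Arguments.
Unset Strict Implicit.
Unset Printing Implicit Defensive.

(** * The recurrence for the bound *)

Lemma disj_bound_empty t : disj_bound 0 t.+1 = 1.
Proof.
rewrite /disj_bound big_nat_recl // bin0 subn0 expn0 muln1 big_nat big1 //.
Qed.

Lemma disj_bound_rec n t :
  disj_bound n.+1 t.+1 = disj_bound n t.+1 + disj_bound n t.+1 + disj_bound n t.
Proof.
rewrite /disj_bound; elim: t => [|t IHt].
  by rewrite !big_nat1 big_geq // !bin0 !subn0 expnS; lia.
rewrite big_nat_recr //= IHt (big_nat_recr t.+1) //= (big_nat_recr t) //=.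
rewrite binS subSS mulnDl; have [tn|nt] := ltnP t n; last first.
  by rewrite (@bin_small n t.+1) // !mul0n; lia.
by rewrite -subnSK // expnS; lia.
Qed.

(** * Counting disjoint pairs through sections at an element *)

Section DisjointPairs.
Variable T : finType.
Implicit Types (x : T) (G S U X Y Z : {set T}) (A B : {set {set T}}).

(** The notions of the statement over an arbitrary finite type: the induction
    shrinks a ground set G inside T, which avoids renumbering the elements. *)
Definition dpairs A B : nat :=
  #|[set p in setX A B | p.1 :&: p.2 == set0]|.

Definition avoiding t A B : Prop :=
  forall X Y, X \in A -> Y \in B -> #|X :&: Y| <> t.

Definition deletion x A := [set X in A | x \notin X].
Definition link x A := [set X : {set T} | (x \notin X) && (x |: X \in A)].

(** The size bound is strict so that the link of [small G t.+1] at a point is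
    [small (G :\ x) t], including the empty family at t = 0. *)
Definition small G t := [set X in powerset G | #|X| < t].

Lemma dpairsE A B :
  dpairs A B = \sum_X \sum_Y [&& X \in A, Y \in B & X :&: Y == set0].
Proof.
rewrite /dpairs -sum1_card big_mkcond pair_big /=.
by apply: eq_bigr => -[X Y] _; rewrite !inE /= -andbA; case: ifP.
Qed.

Lemma dpairsC A B : dpairs A B = dpairs B A.
Proof.
rewrite !dpairsE exchange_big; apply: eq_bigr => X _; apply: eq_bigr => Y _.
by rewrite setIC andbCA.
Qed.

Lemma avoidingC t A B : avoiding t A B -> avoiding t B A.
Proof. by move=> av X Y XB YA; rewrite setIC; apply: av. Qed.

Lemma dpairs_gt0 A B X Y :
  X \in A -> Y \in B -> X :&: Y = set0 -> 0 < dpairs A B.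
Proof.
move=> XA YB XY0; rewrite /dpairs; apply/card_gt0P; exists (X, Y).
by rewrite !inE XA YB /= XY0.
Qed.

Lemma dpairs_neq0 A B : dpairs A B != 0 ->
  exists X Y, [/\ X \in A, Y \in B & X :&: Y = set0].
Proof.
rewrite -lt0n => /card_gt0P[[X Y]]; rewrite !inE /= => /andP[/andP[XA YB] /eqP].
by exists X, Y.
Qed.

Lemma dpairs_avoid0 A B : avoiding 0 A B -> dpairs A B = 0.
Proof.
move=> av; apply/eqP/negPn/negP => /dpairs_neq0[X [Y [XA YB XY0]]].
by apply: (av X Y XA YB); rewrite XY0 cards0.
Qed.

(** The map X |-> x |: X pairs the sets avoiding x with those containing x. *)
Lemma sum_sets_split x (F : {set T} -> nat) :
  \sum_X F X = \sum_(X : {set T} | x \notin X) (F X + F (x |: X)).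
Proof.
rewrite (bigID (fun X : {set T} => x \notin X)) /= big_split /=; congr addn.
rewrite (reindex_onto (fun X => x |: X) (fun X => X :\ x)) /=; last first.
  by move=> X; rewrite negbK => /setD1K.
apply: eq_bigl => X; rewrite setU11 /=.
apply/eqP/idP => [<-|xX]; first by rewrite setD11.
by rewrite setU1K.
Qed.

Lemma sum_pairs_split x (F : {set T} -> {set T} -> nat) :
  \sum_X \sum_Y F X Y =
  \sum_(X : {set T} | x \notin X) \sum_(Y : {set T} | x \notin Y)
     (F X Y + F X (x |: Y) + F (x |: X) Y + F (x |: X) (x |: Y)).
Proof.
rewrite (sum_sets_split x); apply: eq_bigr => X _.
rewrite 2!(sum_sets_split x) -big_split /=.
by apply: eq_bigr => Y _; rewrite !addnA.
Qed.

(** The fourth term, with x on both sides, vanishes since such sets meet in x. *)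
Lemma dpairs_split x A B :
  dpairs A B = dpairs (deletion x A) (deletion x B)
    + dpairs (deletion x A) (link x B) + dpairs (link x A) (deletion x B).
Proof.
rewrite !dpairsE !(sum_pairs_split x) -!big_split /=.
apply: eq_bigr => X xX; rewrite -!big_split /=; apply: eq_bigr => Y xY.
have x1I Z : x \notin Z -> [set x] :&: Z = set0.
  by move=> xZ; apply/eqP; rewrite setI_eq0 disjoints1.
have DIr : X :&: (x |: Y) = X :&: Y by rewrite setIUr (setIC X) x1I ?set0U.
have DIl : (x |: X) :&: Y = X :&: Y by rewrite setIUl x1I ?set0U.
have DU : ((x |: X) :&: (x |: Y) == set0) = false.
  by apply/negbTE; apply/set0Pn; exists x; rewrite !inE eqxx.
by rewrite !inE !DIr !DIl !DU eqxx xX xY /= !andbF !andbT /= !addn0.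
Qed.

(** Both sides are sums over disjoint pairs (X, Y), and the identity already
    holds for the contribution of each pair, a Boolean function of the four
    memberships. The right-hand side is the useful form: for sections at a
    point, its last pair avoids an intersection size smaller by one, which
    matches the recurrence [disj_bound_rec]. *)
Lemma dpairs_union_inter (A0 A1 B0 B1 : {set {set T}}) :
  dpairs A0 B0 + dpairs A0 B1 + dpairs A1 B0
    + dpairs (A0 :\: A1) (B0 :\: B1)
  = dpairs A0 (B0 :|: B1) + dpairs (A0 :|: A1) B0
    + dpairs (A0 :&: A1) (B0 :&: B1).
Proof.
rewrite !dpairsE -!big_split /=; apply: eq_bigr => X _.
rewrite -!big_split /=; apply: eq_bigr => Y _; rewrite !inE.
by case: (X \in A0) (X \in A1) (Y \in B0) (Y \in B1) (_ == _) => [] [] [] [] [].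
Qed.

Lemma in_deletion x A X : (X \in deletion x A) = (X \in A) && (x \notin X).
Proof. by rewrite inE. Qed.

Lemma in_link x A X : (X \in link x A) = (x \notin X) && (x |: X \in A).
Proof. by rewrite inE. Qed.

Lemma eq_sections x A B :
  deletion x A = deletion x B -> link x A = link x B -> A = B.
Proof.
move=> /setP eqD /setP eqL; apply/setP => X.
have [xX|xX] := boolP (x \in X).
  by have := eqL (X :\ x); rewrite !in_link setD11 setD1K.
by have := eqD X; rewrite !in_deletion xX !andbT.
Qed.

Lemma deletion_powerset x G : deletion x (powerset G) = powerset (G :\ x).
Proof. by apply/setP => X; rewrite in_deletion !powersetE subsetD1. Qed.

Lemma link_powerset x G :
  link x (powerset G) = if x \in G then powerset (G :\ x) else set0.
Proof.
apply/setP => X; rewrite in_link powersetE subUset sub1set.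
case: ifP => xG; last by rewrite andbF in_set0.
by rewrite powersetE subsetD1 andbC.
Qed.

Lemma deletion_small x G t : deletion x (small G t) = small (G :\ x) t.
Proof.
by apply/setP => X; rewrite in_deletion !inE subsetD1; case: (x \in X); lia.
Qed.

Lemma link_small x G t : x \in G -> link x (small G t.+1) = small (G :\ x) t.
Proof.
move=> xG; apply/setP => X; rewrite in_link !inE subsetD1 subUset sub1set xG /=.
by have [xX|xX] := boolP (x \in X); rewrite ?andbF // andbT cardsU1 xX.
Qed.

Lemma deletionS x A B : A \subset B -> deletion x A \subset deletion x B.
Proof.
move=> /subsetP AB; apply/subsetP => X; rewrite !in_deletion.
by case/andP=> /AB ->.
Qed.

Lemma linkS x A B : A \subset B -> link x A \subset link x B.
Proof.
move=> /subsetP AB; apply/subsetP => X; rewrite !in_link.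
by case/andP=> -> /AB.
Qed.

(** * The upper bound *)

Definition admissible G t A B : Prop :=
  [/\ A \subset powerset G, B \subset powerset G & avoiding t A B].

Lemma admissibleC G t A B : admissible G t A B -> admissible G t B A.
Proof. by case=> ? ? /avoidingC. Qed.

(** A set avoiding x meets Y and x |: Y in the same set. *)
Lemma admissible_union G t A B x : x \in G -> admissible G t A B ->
  admissible (G :\ x) t (deletion x A) (deletion x B :|: link x B).
Proof.
move=> xG [AG BG av]; split.
- by rewrite -deletion_powerset deletionS.
- rewrite subUset -{1}deletion_powerset deletionS //=.
  by have := linkS x BG; rewrite link_powerset xG.
move=> X Y; rewrite in_setU !in_deletion in_link => /andP[XA xX].
case/orP=> [/andP[YB _]|/andP[xY YB]]; first exact: av.
have <- : X :&: (x |: Y) = X :&: Y; last exact: av.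
by apply/setP => z; rewrite !inE; case: eqP => // ->; rewrite (negbTE xX).
Qed.

(** If X and Y had t common elements, x |: X and x |: Y would have t + 1. *)
Lemma admissible_inter G t A B x : x \in G -> admissible G t.+1 A B ->
  admissible (G :\ x) t (deletion x A :&: link x A) (deletion x B :&: link x B).
Proof.
move=> xG [AG BG av]; split.
- by rewrite subIset // -deletion_powerset deletionS.
- by rewrite subIset // -deletion_powerset deletionS.
move=> X Y; rewrite !in_setI !in_link.
case/and3P=> _ xX XA /and3P[_ xY YB] XYt.
by apply: (av _ _ XA YB); rewrite -setUIr cardsU1 inE (negbTE xX) XYt.
Qed.

Lemma dpairs_sections x A B :
  dpairs A B + dpairs (deletion x A :\: link x A) (deletion x B :\: link x B)
  = dpairs (deletion x A) (deletion x B :|: link x B)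
  + dpairs (deletion x A :|: link x A) (deletion x B)
  + dpairs (deletion x A :&: link x A) (deletion x B :&: link x B).
Proof. by rewrite (dpairs_split x) dpairs_union_inter. Qed.

Lemma powerset_ground0 G A : #|G| = 0 -> A \subset powerset G ->
  A \subset [set set0].
Proof. by move=> /cards0_eq->; rewrite powerset0. Qed.

Lemma dpairs_bound G t A B :
  admissible G t A B -> dpairs A B <= disj_bound #|G| t.
Proof.
elim: {G}#|G| {-2}G (erefl #|G|) t A B => [|n IHn] G Gn [|t] A B adm.
- by case: adm => _ _ /dpairs_avoid0->.
- case: adm => /(powerset_ground0 Gn)/subset_leq_card.
  rewrite cards1 => A1 /(powerset_ground0 Gn)/subset_leq_card.
  rewrite cards1 => B1 _; rewrite Gn disj_bound_empty.
  apply: leq_trans (_ : #|setX A B| <= _).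
    by apply/subset_leq_card/subsetP => p; rewrite inE => /andP[].
  by rewrite cardsX -(muln1 1) leq_mul.
- by case: adm => _ _ /dpairs_avoid0->.
have [x xG] : exists x, x \in G by apply/set0Pn; rewrite -card_gt0 Gn.
have Gxn : #|G :\ x| = n by have := cardsD1 x G; rewrite xG Gn => -[].
have le1 := IHn _ Gxn _ _ _ (admissible_union xG adm).
have le2 := IHn _ Gxn _ _ _ (admissible_union xG (admissibleC adm)).
have le3 := IHn _ Gxn _ _ _ (admissible_inter xG adm).
rewrite !Gxn in le1 le2 le3.
have := dpairs_sections x A B; rewrite Gn disj_bound_rec.
by move: le2; rewrite dpairsC; lia.
Qed.

(** * Extremal pairs *)

Definition extremal G t A B : Prop :=
  admissible G t A B /\ dpairs A B = disj_bound #|G| t.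

Lemma extremalC G t A B : extremal G t A B -> extremal G t B A.
Proof. by case=> /admissibleC; rewrite dpairsC. Qed.

(** Equality in the bound for (A, B) forces equality in each of the three bounds
    that are summed, and leaves no room for the correction term. *)
Lemma extremal_sections G t A B x : x \in G -> extremal G t.+1 A B ->
  [/\ extremal (G :\ x) t.+1 (deletion x A) (deletion x B :|: link x B),
      extremal (G :\ x) t.+1 (deletion x A :|: link x A) (deletion x B),
      extremal (G :\ x) t
        (deletion x A :&: link x A) (deletion x B :&: link x B)
    & dpairs (deletion x A :\: link x A) (deletion x B :\: link x B) = 0].
Proof.
move=> xG [adm]; have := dpairs_sections x A B.
have adm1 := admissible_union xG adm.
have adm2 := admissibleC (admissible_union xG (admissibleC adm)).
have adm3 := admissible_inter xG adm.
have := (dpairs_bound adm1, dpairs_bound adm2, dpairs_bound adm3).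
rewrite (cardsD1 x G) xG disj_bound_rec => -[[le1 le2] le3] E1 E2.
by split; [split=> //|split=> //|split=> //|]; lia.
Qed.

Lemma extremal_ground0 G t A B : #|G| = 0 -> extremal G t.+1 A B ->
  A = [set set0] /\ B = [set set0].
Proof.
move=> G0 [[AG BG _]]; rewrite G0 disj_bound_empty => d1.
have [|X [Y [XA YB _]]] := @dpairs_neq0 A B; first by rewrite d1.
have := powerset_ground0 G0 AG; have := powerset_ground0 G0 BG.
rewrite !subset1; case/orP=> /eqP E1; last by rewrite E1 inE in YB.
by case/orP=> /eqP E2; last by rewrite E2 inE in XA.
Qed.

(** * The case t = 1 *)

Lemma powerset_inj : injective (@powerset T).
Proof.
move=> S U E; apply/eqP; rewrite eqEsubset.
by rewrite -[S \subset U]powersetE -E powersetE subxx -powersetE E powersetE /=.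
Qed.

Lemma setDDK G S : S \subset G -> G :\: (G :\: S) = S.
Proof. by move=> SG; rewrite setDDr setDv set0U (setIidPr SG). Qed.

(** The half of the inductive step for t = 1 in which [set x] belongs to A.
    Then no member of B contains x, so the two descriptions of the sets of B
    avoiding x agree and U = S. The correction term, tested against the empty
    set on the side of B, shows that every subset of S extends by x in A. *)
Lemma extremal1_link G S U A B x :
    x \in G -> S \subset G :\ x -> U \subset G :\ x -> extremal G 1 A B ->
    deletion x A = powerset S ->
    deletion x B :|: link x B = powerset ((G :\ x) :\: S) ->
    deletion x A :|: link x A = powerset U ->
    deletion x B = powerset ((G :\ x) :\: U) ->
    set0 \in link x A ->
  A = powerset (x |: S) /\ B = powerset (G :\: (x |: S)).
Proof.
move=> xG SG UG ext A0 B01 A01 B0 L0.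
have xS : x \notin S by case/subsetD1P: SG.
have [_ _ _ d0] := extremal_sections xG ext; case: ext => -[_ _ av] _.
have B1 : link x B = set0.
  apply/setP => Y; rewrite in_set0; apply/negbTE/negP.
  move: L0; rewrite !in_link setU0 => /andP[_ xA] /andP[xY YB].
  by apply: (av _ _ xA YB); rewrite (setIidPl _) ?cards1 ?sub1set ?setU11.
have US : U = S.
  move: B01; rewrite B1 setU0 B0 => /powerset_inj E.
  by rewrite -(setDDK UG) E setDDK.
have A1 : link x A = powerset S.
  apply/eqP; rewrite eqEsubset -{1}US -A01 subsetUr /=.
  apply/subsetP => X XS; apply: contraT => XA1.
  suff: 0 < dpairs (deletion x A :\: link x A) (deletion x B :\: link x B).
    by rewrite d0.
  apply: (@dpairs_gt0 _ _ X set0); last by rewrite setI0.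
    by rewrite in_setD XA1 A0.
  by rewrite B1 setD0 B0 powersetE sub0set.
split; apply: (@eq_sections x).
- by rewrite A0 deletion_powerset setU1K.
- by rewrite A1 link_powerset setU11 setU1K.
- by rewrite B0 US deletion_powerset !setDDl setUAC setUid.
- by rewrite B1 link_powerset !inE eqxx.
Qed.

Lemma extremal1 G A B : extremal G 1 A B ->
  exists2 S : {set T}, S \subset G & A = powerset S /\ B = powerset (G :\: S).
Proof.
elim: {G}#|G| {-2}G (erefl #|G|) A B => [|n IHn] G Gn A B ext.
  have [-> ->] := extremal_ground0 Gn ext; exists set0; first exact: sub0set.
  by rewrite (cards0_eq Gn) setD0 powerset0.
have [x xG] : exists x, x \in G by apply/set0Pn; rewrite -card_gt0 Gn.
have Gxn : #|G :\ x| = n by have := cardsD1 x G; rewrite xG Gn => -[].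
have xGS (S : {set T}) : S \subset G :\ x -> x |: S \subset G.
  by move=> SG; rewrite subUset sub1set xG (subset_trans SG) ?subsetDl.
have [e1 e2 _ d0] := extremal_sections xG ext.
have [S SG [A0 B01]] := IHn _ Gxn _ _ e1.
have [U UG [A01 B0]] := IHn _ Gxn _ _ e2.
have [LA|LA] := boolP (set0 \in link x A).
  exists (x |: S); first exact: xGS.
  exact: (extremal1_link xG SG UG ext A0 B01 A01 B0 LA).
have [LB|LB] := boolP (set0 \in link x B).
  (* Exchanging A and B replaces S and U by the complements of U and S. *)
  pose V := (G :\ x) :\: U; pose W := (G :\ x) :\: S.
  have VG : V \subset G :\ x := subsetDl _ _.
  have WG : W \subset G :\ x := subsetDl _ _.
  have [] := extremal1_link xG VG WG (extremalC ext) B0 _ B01 _ LB.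
  - by rewrite setDDK.
  - by rewrite setDDK.
  move=> -> ->; exists (G :\: (x |: V)); first exact: subsetDl.
  by rewrite setDDK ?xGS.
(* Otherwise the pair of empty sets contributes to the correction term. *)
suff: 0 < dpairs (deletion x A :\: link x A) (deletion x B :\: link x B).
  by rewrite d0.
apply: (@dpairs_gt0 _ _ set0 set0); last by rewrite setI0.
  by rewrite in_setD LA A0 powersetE sub0set.
by rewrite in_setD LB B0 powersetE sub0set.
Qed.

(** * The case t >= 2 *)

Definition is_small_full G t A B : Prop :=
  A = small G t /\ B = powerset G.

(** Once B0 n B1 is the full power set, so are B0 and B1. In both alternatives
    for the other two pairs, the partner of a full power set is [small]: the
    alternative that makes the partner full also makes the two families equal. *)
Lemma small_full_link G t A B x : x \in G ->
    admissible G t.+1 A B ->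
    is_small_full (G :\ x) t.+1 (deletion x A) (deletion x B :|: link x B) \/
    is_small_full (G :\ x) t.+1 (deletion x B :|: link x B) (deletion x A) ->
    is_small_full (G :\ x) t.+1 (deletion x A :|: link x A) (deletion x B) \/
    is_small_full (G :\ x) t.+1 (deletion x B) (deletion x A :|: link x A) ->
    is_small_full (G :\ x) t
      (deletion x A :&: link x A) (deletion x B :&: link x B) ->
  is_small_full G t.+1 A B.
Proof.
move=> xG [_ BG _] e1 e2 [A2 B2].
have B0 : deletion x B = powerset (G :\ x).
  apply/eqP; rewrite eqEsubset -{2}B2 subsetIl andbT.
  by rewrite -deletion_powerset deletionS.
have B1 : link x B = powerset (G :\ x).
  apply/eqP; rewrite eqEsubset -{2}B2 subsetIr andbT.
  by have := linkS x BG; rewrite link_powerset xG.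
have A0 : deletion x A = small (G :\ x) t.+1.
  by move: e1; rewrite B0 B1 setUid => -[[-> _]|[<- ->]].
have A01 : deletion x A :|: link x A = small (G :\ x) t.+1.
  by move: e2; rewrite B0 => -[[-> _]|[<- ->]].
have A1 : link x A = small (G :\ x) t.
  by rewrite -A2; apply/esym/setIidPr; rewrite A0 -A01 subsetUr.
split; apply: (@eq_sections x).
- by rewrite A0 deletion_small.
- by rewrite A1 link_small.
- by rewrite B0 deletion_powerset.
- by rewrite B1 link_powerset xG.
Qed.

Lemma small1 G : small G 1 = powerset set0.
Proof.
apply/setP => X; rewrite !inE subset0 ltnS leqn0 cards_eq0.
by case: eqP => [->|_]; rewrite ?sub0set ?andbF.
Qed.

(** At t >= 2 both extremal families contain all singletons, which provides the
    witnesses against a proper nonempty S in [extremal_ge2]. *)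
Lemma small_full_mem1 G t A B z : z \in G ->
  is_small_full G t.+2 A B \/ is_small_full G t.+2 B A -> [set z] \in A.
Proof.
by move=> zG [[-> _]|[_ ->]]; rewrite !inE sub1set zG ?cards1.
Qed.

(** The statement holds for t larger than the size of G too, where [small G t]
    is the full power set; thus the induction on G starts at the empty set and
    needs no separate treatment of t = #|G|. *)
Lemma extremal_ge2 G t A B : extremal G t.+2 A B ->
  is_small_full G t.+2 A B \/ is_small_full G t.+2 B A.
Proof.
elim: {G}#|G| {-2}G (erefl #|G|) t A B => [|n IHn] G Gn t A B ext.
  have [-> ->] := extremal_ground0 Gn ext; left.
  rewrite /is_small_full (cards0_eq Gn) powerset0; split => //.
  apply/setP => X; rewrite !inE subset0.
  by case: eqP => [->|]; rewrite ?cards0.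
have [x xG] : exists x, x \in G by apply/set0Pn; rewrite -card_gt0 Gn.
have Gxn : #|G :\ x| = n by have := cardsD1 x G; rewrite xG Gn => -[].
have [/(IHn _ Gxn) e1 /(IHn _ Gxn) e2 e3 d0] := extremal_sections xG ext.
suff [e|e] :
    is_small_full (G :\ x) t.+1
      (deletion x A :&: link x A) (deletion x B :&: link x B) \/
    is_small_full (G :\ x) t.+1
      (deletion x B :&: link x B) (deletion x A :&: link x A).
- by left; apply: small_full_link e1 e2 e => //; case: ext.
- right; apply: small_full_link e => //; first by case: ext => /admissibleC.
    by case: e2; [right|left].
  by case: e1; [right|left].
(* Except when the third pair is 1-avoiding, it is covered by the induction. *)
case: t {ext} e1 e2 e3 d0 => [|t] e1 e2 e3 d0; last exact: IHn e3.
have [S SG [A2 B2]] := extremal1 e3; rewrite A2 B2 /is_small_full !small1.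
have [->|/set0Pn[y yS]] := eqVneq S set0; first by left; rewrite setD0.
have [GS|/set0Pn[z zGS]] := eqVneq ((G :\ x) :\: S) set0.
  right; rewrite GS; split=> //; congr powerset; apply/eqP.
  by rewrite eqEsubset SG -setD_eq0 GS eqxx.
(* With y in S and z outside, {z} is missing from A1 and {y} from B1, so the
   disjoint pair ({z}, {y}) contributes to the correction term. *)
move: (zGS); rewrite in_setD => /andP[zS zG].
suff: 0 < dpairs (deletion x A :\: link x A) (deletion x B :\: link x B).
  by rewrite d0.
have zA := small_full_mem1 zG e1.
have yB : [set y] \in deletion x B.
  by apply: (small_full_mem1 (subsetP SG y yS)); case: e2; [right|left]; eassumption.
apply: (@dpairs_gt0 _ _ [set z] [set y]).
- have := in_setI [set z] (deletion x A) (link x A).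
  by rewrite A2 zA powersetE sub1set (negbTE zS) in_setD zA => /= <-.
- have := in_setI [set y] (deletion x B) (link x B).
  by rewrite B2 yB powersetE sub1set in_setD yS /= [in X in _ -> X]in_setD yB => <-.
apply/eqP; rewrite setI_eq0 disjoints1 inE; apply: contraNneq zS => ->; exact: yS.
Qed.

(** * The extremal examples attain the bound *)

Lemma dpairs_powersetD S : dpairs (powerset S) (powerset (~: S)) = 2 ^ #|T|.
Proof.
rewrite /dpairs (_ : [set p in _ | _] = setX (powerset S) (powerset (~: S))).
  by rewrite cardsX !card_powerset -expnD cardsC.
apply/setP => -[X Y]; rewrite !inE /=; apply: andb_idr => /andP[XS YS].
rewrite setI_eq0 disjoints_subset (subset_trans XS) //.
by rewrite -(setCK S) setCS.
Qed.

Lemma sum_small_sets t :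
  \sum_(X : {set T} | #|X| < t) 2 ^ (#|T| - #|X|) = disj_bound #|T| t.
Proof.
rewrite /disj_bound; elim: t => [|t IHt]; first by rewrite big_geq // big_pred0.
rewrite big_nat_recr //= -IHt (bigID (fun X : {set T} => #|X| < t)) /=.
congr addn; first by apply: eq_bigl => X; lia.
rewrite -card_draws -sum_nat_const; apply: eq_big => X; first by rewrite inE; lia.
by move=> tX; rewrite (_ : #|X| = t) //; lia.
Qed.

Lemma dpairs_small_full t :
  dpairs (small setT t) (powerset setT) = disj_bound #|T| t.
Proof.
rewrite dpairsE -sum_small_sets [RHS]big_mkcond; apply: eq_bigr => X _.
rewrite inE powersetE subsetT /=; case: ifP => _; last by rewrite big1.
have -> : #|T| - #|X| = #|~: X| by rewrite [RHS]cardsCs setCK.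
rewrite -card_powerset -sum1_card [RHS]big_mkcond; apply: eq_bigr => Y _.
rewrite !powersetE subsetT /= setIC setI_eq0 disjoints_subset.
by case: (Y \subset ~: X).
Qed.

End DisjointPairs.

(** * The theorem *)

Theorem mainTheorem3 (n t : nat) (A B : {set {set 'I_n}})
    (n_gt0 : 0 < n) (t_gt0 : 0 < t) (t_le_n : t <= n)
    (avoidAB : cross_avoiding t A B) :
  [/\ disj_pairs A B <= disj_bound n t,
      t = 1 ->
        disj_bound n t = 2 ^ n /\
        (disj_pairs A B = disj_bound n t <->
         exists S : {set 'I_n},
           (A = powerset S /\ B = powerset (~: S)) \/
           (B = powerset S /\ A = powerset (~: S)))
    & 2 <= t ->
        (disj_pairs A B = disj_bound n t <->
         (A = subsets_le n (t - 1) /\ B = powerset [set: 'I_n]) \/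
         (A = powerset [set: 'I_n] /\ B = subsets_le n (t - 1)))].
Proof.
have adm : admissible setT t A B.
  by split=> //; apply/subsetP => X _; rewrite powersetE subsetT.
have extP : disj_pairs A B = disj_bound n t <-> extremal setT t A B.
  by rewrite /extremal cardsT card_ord; split=> [|[]].
have d1 : disj_bound n 1 = 2 ^ n by rewrite /disj_bound big_nat1 bin0 subn0 mul1n.
split=> [|t1|t2].
- by have := dpairs_bound adm; rewrite cardsT card_ord.
- subst t; split=> //; split=> [/extP/extremal1[S _ [-> ->]]|[S]].
    by exists S; left; rewrite setTD.
  rewrite d1 -[n in 2 ^ n]card_ord => -[] [-> ->].
    exact: dpairs_powersetD.
  by rewrite -(dpairs_powersetD S) dpairsC.
have -> : subsets_le n (t - 1) = small setT t.
  by apply/setP => X; rewrite !inE subsetT subn1 -ltnS prednK.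
have full := dpairs_small_full 'I_n t; rewrite card_ord in full.
case: t t2 {t_gt0 t_le_n avoidAB adm} extP full => [|[|t]] // _ extP full.
split=> [/extP/extremal_ge2[[-> ->]|[-> ->]]|[[-> ->]|[-> ->]]]; auto.
by rewrite -full dpairsC.
Qed.
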